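(* Let $c>0$ be a known constant, $\epsilon \in (0,1/3)$ and $\delta\in(0,1)$, and let $$t = \left\lceil \left(\frac{c}{\epsilon} \right)^2 f(\epsilon) \right\rceil \left(2 \left\lceil\frac{\ln(2\delta^{-1})}{\ln(4/3)} \right\rceil + 1 \right).$$ Then there is a randomized estimator $\hat\mu$, computed from $t$ samples $X_1,\ldots,X_t$ (and depending only on $c,\epsilon,\delta$, these samples, and auxiliary randomness independent of the samples), such that for every independent, identically distributed sequence $X_1,X_2,\ldots$ of real random variables with mean $\mu$ and standard deviation at most $c\mu$, $$\mathbb{P}(|\hat\mu-\mu|>\epsilon\mu)\le\delta .$$
   Context: For $\epsilon\in(0,1)$, $f(\epsilon) = (1 - \epsilon)^{-2}(1 + \epsilon - \epsilon^2)^{-1}(1 + \epsilon)$. A randomized estimator using $X_1,\dots,X_t$ is a random variable of the form $\hat\mu=g(X_1,\ldots,X_t,U)$, where $g$ is a measurable function that may depend on $c,\epsilon,\delta$ but not on $\mu$ or on the distribution of the $X_i$, and $U$ is auxiliary randomness with a fixed distribution depending only on $c,\epsilon,\delta$ (for instance a finite vector of independent uniform random variables), independent of $(X_1,\ldots,X_t)$. *)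

(* Defs.v *)
From HB Require Import structures.
From mathcomp Require Import all_boot all_order all_algebra finmap.
From mathcomp Require Import all_classical all_reals all_analysis.

Set Implicit Arguments.
Unset Strict Implicit.
Unset Printing Implicit Defensive.

Import Order.TTheory GRing.Theory Num.Theory.
Import numFieldNormedType.Exports.

Local Open Scope classical_set_scope.
Local Open Scope ring_scope.

Definition mutually_independent d (Omega : measurableType d) (R : realType)
    (P : probability Omega R) d' (T : measurableType d') (I : choiceType)
    (X : I -> Omega -> T) : Prop :=
  forall (J : {fset I}) (A : I -> set T), (forall i, measurable (A i)) ->
    P (\bigcap_(i in [set` J]) (X i @^-1` A i)) =
    (\prod_(i <- J) P (X i @^-1` A i))%E.

Definition independent2 d (Omega : measurableType d) (R : realType)
    (P : probability Omega R) d1 (T1 : measurableType d1)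
    d2 (T2 : measurableType d2) (X : Omega -> T1) (Y : Omega -> T2) : Prop :=
  forall (A : set T1) (B : set T2), measurable A -> measurable B ->
    P (X @^-1` A `&` Y @^-1` B) = (P (X @^-1` A) * P (Y @^-1` B))%E.

Definition has_distribution d (Omega : measurableType d) (R : realType)
    (P : probability Omega R) d' (T : measurableType d')
    (X : {RV P >-> T}) (nu : probability T R) : Prop :=
  forall A : set T, measurable A -> distribution P X A = nu A.

Definition identically_distributed d (Omega : measurableType d) (R : realType)
    (P : probability Omega R) d' (T : measurableType d') (I : Type)
    (X : I -> {RV P >-> T}) : Prop :=
  forall i j : I, has_distribution (X i) (distribution P (X j)).

Definition iid d (Omega : measurableType d) (R : realType)
    (P : probability Omega R) d' (T : measurableType d') (I : choiceType)
    (X : I -> {RV P >-> T}) : Prop :=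
  mutually_independent P (fun i : I => X i : Omega -> T) /\
  identically_distributed X.

(* Infinite variance gives +oo. *)
Definition std_dev d (Omega : measurableType d) (R : realType)
    (P : probability Omega R) (X : {RV P >-> R}) : \bar R :=
  sqrte ('V_P[X])%E.

(* X_1, ..., X_t of a sequence are [X 0], ..., [X t.-1]. *)
Definition first_samples (t : nat) (Omega T : Type) (X : nat -> Omega -> T)
    (w : Omega) : t.-tuple T :=
  [tuple X i w | i < t].

(* A measurable map of the t samples and of an auxiliary variable whose law is
   fixed once and for all; the auxiliary space is arbitrary. *)
Record randomized_estimator (R : realType) (t : nat) := RandomizedEstimator {
  aux_display : measure_display ;
  aux_space : measurableType aux_display ;
  aux_law : probability aux_space R ;
  estimate : {mfun (t.-tuple R * aux_space)%type >-> R}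
}.

Definition f_factor {R : realType} (eps : R) : R :=
  (1 - eps) ^- 2 * (1 + eps - eps ^+ 2)^-1 * (1 + eps).

(* Both ceilings are taken of nonnegative reals when [0 < c], [0 < eps < 1] and
   [0 < delta < 1], so that the absolute value of the integer is harmless. *)
Definition num_samples {R : realType} (c eps delta : R) : nat :=
  (`|Num.ceil ((c / eps) ^+ 2 * f_factor eps)%R|
   * (2 * `|Num.ceil (ln (2 * delta^-1) / ln (4 / 3) : R)%R| + 1))%N.

(* Main.v *)
From HB Require Import structures.
Require Import Defs.
From mathcomp Require Import all_boot all_order all_algebra finmap.
From mathcomp Require Import all_classical all_reals all_analysis.
From mathcomp Require Import measurable_realfun ring lra zify.
Import Order.TTheory GRing.Theory Num.Theory.
Import numFieldNormedType.Exports.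

Local Open Scope classical_set_scope.
Local Open Scope ring_scope.

(** The samples are split into [2 * k + 1] blocks of size [m], where [m] and [k] are
    the two ceilings in the number of samples. By independence a block mean [S] has
    expectation [mu] and variance at most [(c * mu) ^+ 2 / m], and since
    [f_factor eps >= (1 - eps) ^- 2] its standard deviation is at most
    [a = eps * mu * (1 - eps)] ([block_size_suffices]).

    For small [eps] the inequality of Cantelli only bounds each of the events
    [S > (1 + eps) * mu] and [S < (1 - eps) * mu] by about 1/2, which is useless for a
    majority vote. The estimator therefore smooths: each block mean is multiplied by
    an independent [V], uniform in [1 - eps, 1 + eps]. Given [S = s] with [s > mu],
    the event [V * s > (1 + eps) * mu] has probability at most
    [kappa * (s - mu)] with [kappa = (1 + eps) / (2 * eps * mu)], and for [s <= mu] it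
    is impossible. Hence its probability is at most [kappa * E[(S - mu)^+]], and
    [E[(S - mu)^+] = E[`|S - mu|] / 2 <= a / 2], so that it is at most
    [kappa * a / 2 = (1 - eps ^+ 2) / 4]. The lower tail satisfies the same bound
    ([smoothed_upper_tail], [smoothed_lower_tail]).

    This is strictly less than 1/4, so [V] may be uniform in a fine enough finite grid
    instead. The auxiliary randomness is then uniform on a finite set, and averaging
    over it is a finite sum.

    The median of the [2 * k + 1] smoothed block means is above a level only if [k.+1]
    of them are. As these are independent and each is too large with probability at
    most 1/4, the Markov inequality for 3 to the number of large ones bounds this by
    [3 ^- k.+1 * (1 + 2 / 4) ^+ (2 * k + 1) = (3 / 4) ^+ k / 2]
    ([majority_bound], [majority_of_smoothed_blocks]). The same holds below, and the
    choice of [k] makes [(3 / 4) ^+ k <= delta / 2].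

    If [mu = 0] the samples vanish almost surely, and so do both tail events; [mu < 0]
    is impossible because the standard deviation is nonnegative. *)

Set Implicit Arguments.
Unset Strict Implicit.
Unset Printing Implicit Defensive.

(** * Independence *)

Section independence_of_generated_sigma_algebras.
Context d (T : measurableType d) (R : realType) (P : probability T R).
Context (I : finType) (G : I -> set (set T)).
Hypothesis mG : forall i, G i `<=` measurable.
Hypothesis IG : forall i, setI_closed (G i).
Hypothesis TG : forall i, G i setT.
Hypothesis PG : forall F : I -> set T, (forall i, G i (F i)) ->
  P (\bigcap_i F i) = (\prod_i P (F i))%E.

Let bigcap_split (F : I -> set T) a :
  \bigcap_i F i = F a `&` \bigcap_(i in [set~ a]) F i.
Proof.
by rewrite -(setvU [set a]) setUC bigcap_setU bigcap_set1.
Qed.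

(** For fixed other events, both sides of the product formula are finite measures
    in the event of index [a]; they agree on the pi-system [G a], hence on the
    sigma-algebra it generates. The indices are treated one after the other. *)
Lemma pi_system_independence (F : I -> set T) :
  (forall i, <<s G i >> (F i)) -> P (\bigcap_i F i) = (\prod_i P (F i))%E.
Proof.
have sGm i : <<s G i >> `<=` measurable.
  by apply: smallest_sub; [exact: sigma_algebra_measurable | exact: mG].
suff main (s : seq I) (H : I -> set T) :
    (forall i, i \in s -> <<s G i >> (H i)) ->
    (forall i, i \notin s -> G i (H i)) ->
    P (\bigcap_i H i) = (\prod_i P (H i))%E.
  move=> sF; apply: (main (enum I)) => i; first by move=> _; exact: sF.
  by rewrite mem_enum.
(* Indices in [s] already carry arbitrary generated events. *)
elim: s H => [|a s IHs] H sH gH.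
  by apply: PG => i; exact: gH.
have [as_|as_] := boolP (a \in s).
  apply: IHs => i; first by move=> si; apply: sH; rewrite inE si orbT.
  move=> si; apply: gH; rewrite inE (negbTE si) orbF.
  by apply: contraNneq si => ->.
have mH i : measurable (H i).
  have [/sH/sGm//|/gH/mG//] := boolP (i \in a :: s).
pose rest := \bigcap_(i in [set~ a]) H i.
have mrest : measurable rest.
  by apply: fin_bigcap_measurable => //; exact: finite_finset.
have q0 : (0 <= \prod_(i | i != a) P (H i))%E by apply: prode_ge0.
have qfin : (\prod_(i | i != a) P (H i))%E \is a fin_num.
  by apply: prode_fin_num => i _; exact: fin_num_measure.
pose q : {nonneg R} := NngNum (fine_ge0 q0).
have qE : (q%:num)%:E = (\prod_(i | i != a) P (H i))%E by rewrite /= fineK.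
rewrite (bigcap_split H a) (bigD1 a)//= muleC -qE.
have -> : P (H a `&` \bigcap_(i in [set~ a]) H i) = mrestr P mrest (H a).
  by [].
have -> : (q%:num%:E * P (H a))%E = mscale q P (H a) by [].
apply: (g_sigma_algebra_measure_unique (G a) _ (fun=> setT)) => //.
- by rewrite bigcup_const//; exists 0%N.
- move=> C GC.
  have := IHs (fun i => if i == a then C else H i).
  rewrite (bigcap_split _ a) (bigD1 a)//= eqxx.
  have -> : \bigcap_(i in [set~ a]) (if i == a then C else H i) = rest.
    by apply: eq_bigcapr => i /= /eqP /negbTE ->.
  under eq_bigr => i /negbTE -> do [].
  rewrite muleC -qE; apply.
  + move=> i si; case: eqP => [ia|_]; last by apply: sH; rewrite inE si orbT.
    by rewrite -ia si in as_.
  + move=> i si; case: eqP => [->//|/eqP ia]; apply: gH.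
    by rewrite inE negb_or ia.
- move=> _; rewrite /= /mrestr setTI.
  by rewrite (le_lt_trans (probability_le1 _ _))// ltry.
- by apply: sH; rewrite mem_head.
Qed.

End independence_of_generated_sigma_algebras.

Section independent_blocks.
Context d (Omega : measurableType d) (R : realType) (P : probability Omega R).
Context d' (T : measurableType d') (K : choiceType) (X : K -> {RV P >-> T}).
Hypothesis indX : mutually_independent P (fun i : K => X i : Omega -> T).

(** Indices outside the range of [e] are assigned the whole space, so that the
    product formula of the definition can be reindexed by [J]. *)
Lemma mutually_independent_inj (J : finType) (e : J -> K) (A : J -> set T) :
    injective e -> (forall j, measurable (A j)) ->
  P (\bigcap_j (X (e j) @^-1` A j)) = (\prod_j P (X (e j) @^-1` A j))%E.
Proof.
move=> e_inj mA.
pose B i := if [pick j | e j == i] is Some j then A j else setT.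
have BE j : B (e j) = A j.
  by rewrite /B; case: pickP => [j' /eqP/e_inj ->//|/(_ j)]; rewrite eqxx.
have mB i : measurable (B i) by rewrite /B; case: pickP.
have := indX [fset e j | j in J]%fset mB.
rewrite big_imfset/=; last by move=> ? ? _ _ /e_inj.
rewrite big_enum/=.
under eq_bigr do rewrite BE.
move=> <-; congr (P _); apply/seteqP; split => w Aw.
  by move=> _ /imfsetP[j _ ->]; rewrite BE; exact: Aw.
by move=> j _; have := Aw (e j); rewrite BE; apply; apply/imfsetP; exists j.
Qed.

Lemma mutually_independent_pair (i j : K) :
  i != j -> independent2 P (X i) (X j).
Proof.
move=> ij A B mA mB.
have e_inj : injective (fun b : bool => if b then i else j).
  by move=> [] []// ijE; move: ij; rewrite ijE eqxx.
have := @mutually_independent_inj _ _ (fun b : bool => if b then A else B) e_inj.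
rewrite big_bool/= => <-; last by case.
congr (P _); apply/seteqP; split => [w [Aw Bw] []//|w AB].
by split; [exact: (AB true) | exact: (AB false)].
Qed.

(** Functions of disjoint blocks of independent variables are independent: the
    rectangle events of each block form a pi-system generating the events that
    depend on this block, and on rectangles the formula is the independence of
    the individual variables. *)
Lemma mutually_independent_blocks (m n : nat) (e : 'I_m -> 'I_n -> K)
    (C : 'I_n -> set (m.-tuple T)) :
    injective (uncurry e) -> (forall j, measurable (C j)) ->
  P (\bigcap_j [set w | C j [tuple X (e i j) w | i < m]]) =
  (\prod_j P [set w | C j [tuple X (e i j) w | i < m]])%E.
Proof.
move=> e_inj mC.
pose rect j (A : 'I_m -> set T) : set Omega :=
  \bigcap_i (X (e i j) @^-1` A i).
pose G j : set (set Omega) :=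
  [set rect j A | A in [set A | forall i, measurable (A i)]].
apply: (@pi_system_independence _ _ _ P _ G).
- move=> j _ [A mA <-]; apply: fin_bigcap_measurable => [|i _].
    exact: finite_finset.
  by rewrite -[X in measurable X]setTI; exact: measurable_funP.
- move=> j _ _ [A mA <-] [B mB <-].
  exists (fun i => A i `&` B i) => [i|]; first exact: measurableI.
  by rewrite /rect -bigcapI.
- by move=> j; exists (fun=> setT) => //; rewrite /rect -subTset => w _ i _.
- move=> F /= GF.
  have /boolp.choice[A AP] (j : 'I_n) : exists A : 'I_m -> set T,
      (forall i, measurable (A i)) /\ F j = rect j A.
    by have [A mA <-] := GF j; exists A.
  have -> : \bigcap_j F j =
      \bigcap_(p : 'I_m * 'I_n) (X (uncurry e p) @^-1` A p.2 p.1).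
    apply/seteqP; split => w Fw.
      by move=> [i j] _ /=; have := Fw j I; rewrite (AP j).2; exact.
    by move=> j _; rewrite (AP j).2 => i _; exact: (Fw (i, j) I).
  rewrite mutually_independent_inj//; last by move=> p; exact: (AP p.2).1.
  transitivity (\prod_j \prod_i P (X (e i j) @^-1` A j i))%E.
    by rewrite exchange_big pair_bigA/=; apply: eq_bigr => -[].
  apply: eq_bigr => j _; rewrite (AP j).2 /rect mutually_independent_inj//.
    by move=> i i' /(e_inj (i, j) (i', j))[].
  exact: (AP j).1.
- move=> j.
  have := mC j; rewrite /measurable/= => mCj.
  have : preimage_set_system setT (fun w => [tuple X (e i j) w | i < m])
      (g_sigma_preimage (fun (i : 'I_m) (x : m.-tuple T) => tnth x i))
      [set w | C j [tuple X (e i j) w | i < m]].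
    by exists (C j) => //; rewrite setTI.
  rewrite -g_sigma_preimage_comp; apply: smallest_sub.
    exact: smallest_sigma_algebra.
  move=> B; rewrite -bigcup_seq => -[i _ [A mA <-]].
  apply: sub_sigma_algebra; exists (fun i' => if i' == i then A else setT).
    by move=> i'; case: ifP.
  rewrite setTI; apply/seteqP; split => w /=.
    by move=> /(_ i I); rewrite /= eqxx /preimage/= tnth_mktuple.
  by rewrite /preimage/= tnth_mktuple => Aw i' _ /=; case: eqP => [->|].
Qed.

End independent_blocks.

(** * Moments *)

Section independent_pairs.
Context d (Omega : measurableType d) (R : realType) (P : probability Omega R).

(** Independence says that the law of [(X, Y)] is the product of the two laws, so
    this is the theorem of Fubini for [(x, y) |-> x * y]. *)
Lemma independent2_expectationM (X Y : {RV P >-> R}) :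
    (X : Omega -> R) \in Lfun P 2%:E -> (Y : Omega -> R) \in Lfun P 2%:E ->
    independent2 P X Y ->
  ('E_P[(X : Omega -> R) * (Y : Omega -> R)] = 'E_P[X] * 'E_P[Y])%E.
Proof.
move=> X2 Y2 indXY.
have Pfin : P [set: Omega] \is a fin_num by exact: fin_num_measure.
have /Lfun1_integrable X1 := Lfun_subset12 Pfin X2.
have Y1' := Lfun_subset12 Pfin Y2.
have /Lfun1_integrable Y1 := Y1'.
have /Lfun1_integrable XY1 := Lfun2_mul_Lfun1 X2 Y2.
have mphi : measurable_fun setT (fun w => (X w, Y w)).
  exact: measurable_fun_pair.
pose phi : {RV P >-> (R * R)%type} :=
  HB.pack (fun w => (X w, Y w)) (isMeasurableFun.Build _ _ _ _ _ mphi).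
pose mul (z : (R * R)%type) : \bar R := (z.1 * z.2)%:E.
have mmul : @measurable_fun _ _ (R * R)%type _ setT mul.
  by apply/measurable_EFinP; apply: measurable_funM.
have joint (A : set (R * R)%type) : measurable A ->
    (distribution P X \x distribution P Y)%E A = distribution P phi A.
  apply: (product_measure_unique (m' := distribution P phi)) => B C mB mC.
  exact: indXY.
have intmul : (distribution P phi).-integrable setT mul.
  exact: integrable_pushforward.
have intprod : (distribution P X \x distribution P Y)%E.-integrable setT mul.
  apply/integrableP; split=> //; have /integrableP[_] := intmul.
  apply: le_lt_trans; rewrite le_eqVlt; apply/orP; left; apply/eqP.
  by apply: eq_measure_integral => A mA _; exact: joint.
rewrite !expectation.unlock.
transitivity (\int[distribution P phi]_z mul z)%E.
  by rewrite integral_distribution.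
transitivity (\int[distribution P X \x distribution P Y]_z mul z)%E.
  by apply: eq_measure_integral => A mA _; exact/esym/joint.
rewrite -integral12_prod_meas1// /fubini_F/=.
have EY x : (\int[distribution P Y]_y mul (x, y) =
    x%:E * \int[P]_w (Y w)%:E)%E.
  rewrite integral_distribution//=; last 2 first.
  - by apply/measurable_EFinP; exact: mulrl_measurable.
  - exact: (integrableZl measurableT x Y1).
  by rewrite -integralZl.
under eq_integral do rewrite EY.
have Yfin := expectation_fin_num Y1'.
rewrite expectation.unlock in Yfin.
rewrite integral_distribution//=; last 2 first.
- by rewrite -(fineK Yfin); apply: emeasurable_funM.
- by rewrite -(fineK Yfin); exact: integrableZr.
by rewrite -(fineK Yfin) -integralZr.
Qed.

End independent_pairs.

Section sums.
Context d (Omega : measurableType d) (R : realType) (P : probability Omega R).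

Lemma variance_sum_uncorrelated (I : eqType) (X : I -> Omega -> R) (s : seq I) :
    uniq s -> (forall i, X i \in Lfun P 2%:E) ->
    (forall i j, i != j -> covariance P (X i) (X j) = 0%E) ->
  ('V_P[(\sum_(i <- s) X i)%R] = \sum_(i <- s) 'V_P[X i])%E.
Proof.
move=> + X2 cov0; elim: s => [_|a s IHs /= /andP[as_ /IHs {}IHs]].
  by rewrite !big_nil variance_cst.
have S2 (r : seq I) : \sum_(i <- r) X i \in Lfun P 2%:E.
  by rewrite rpred_sum ?lee1n.
rewrite !big_cons varianceD// IHs.
suff -> : covariance P (X a) (\sum_(i <- s) X i) = 0%E by rewrite mule0 adde0.
elim: s as_ {IHs} => [_|b s IHs]; first by rewrite big_nil covariance_cst_r.
rewrite inE negb_or => /andP[ab as_].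
by rewrite big_cons covarianceDr// cov0// IHs// adde0.
Qed.

End sums.

Section moments.
Context d (Omega : measurableType d) (R : realType) (P : probability Omega R).

Lemma expectation_sum_indic (J : finType) (A : J -> set Omega) (c : J -> R) :
    (forall j, measurable (A j)) -> (forall j, 0 <= c j) ->
  'E_P[(fun w => \sum_j c j * \1_(A j) w)%R]%E =
    (\sum_j (c j)%:E * P (A j))%E.
Proof.
move=> mA c0; rewrite expectation.unlock.
have m1 j : measurable_fun setT (fun w => c j * \1_(A j) w).
  by apply: measurable_funM => //; exact: measurable_indic.
under eq_integral do rewrite -sumEFin.
rewrite ge0_integral_sum//=; last 2 first.
- by move=> j; exact/measurable_EFinP.
- by move=> j w _; rewrite lee_fin mulr_ge0.
apply: eq_bigr => j _; under eq_integral do rewrite EFinM.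
rewrite ge0_integralZl//= ?lee_fin//.
- by rewrite integral_indic// setIT.
- by apply/measurable_EFinP; exact: measurable_indic.
Qed.

(** The form in which a pointwise inequality on indicators is integrated below:
    for the smoothing bound and for the exponential Markov inequality. *)
Lemma sum_probability_le_expectation (J : finType) (A : J -> set Omega)
    (c : J -> R) (g : Omega -> R) :
    (forall j, measurable (A j)) -> (forall j, 0 <= c j) ->
    measurable_fun setT g -> (forall w, \sum_j c j * \1_(A j) w <= g w) ->
  (\sum_j (c j)%:E * P (A j) <= 'E_P[g])%E.
Proof.
move=> mA c0 mg Ag; rewrite -expectation_sum_indic//.
have Z0 w : 0 <= \sum_j c j * \1_(A j) w.
  by apply: sumr_ge0 => j _; rewrite mulr_ge0.
apply: expectation_le => //.
- apply: measurable_sum => j.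
  by apply: measurable_funM => //; exact: measurable_indic.
- by move=> w; exact: le_trans (Ag w).
- exact: nearW.
Qed.

Lemma expectation_quadratic (S : Omega -> R) (mu a b c : R) :
    S \in Lfun P 2%:E -> 'E_P[S]%E = mu%:E ->
  'E_P[(fun w => a + b * (S w - mu) + c * (S w - mu) ^+ 2)%R]%E =
  (a%:E + c%:E * 'V_P[S])%E.
Proof.
move=> S2 ES.
have Pfin : P [set: Omega] \is a fin_num by exact: fin_num_measure.
have S1 := Lfun_subset12 Pfin S2.
pose D : Omega -> R := S \- cst mu.
have D2 : D \in Lfun P 2%:E.
  by rewrite /D rpredB ?lee1n// => ?; exact: Lfun_cst.
have D1 : D \in Lfun P 1 := Lfun_subset12 Pfin D2.
have ED : 'E_P[D]%E = 0%E.
  by rewrite expectationB ?Lfun_cst// ES expectation_cst subee.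
have DD1 : D \* D \in Lfun P 1 := Lfun2_mul_Lfun1 D2 D2.
have EDD : 'E_P[D \* D]%E = 'V_P[S]%E.
  by rewrite /variance covariance.unlock ES.
have -> : (fun w => a + b * (S w - mu) + c * (S w - mu) ^+ 2) =
    (cst a \+ b \o* D) \+ c \o* (D \* D).
  by apply/funext => w /=; rewrite expr2 (mulrC b) (mulrC c).
have a1 : (cst a : Omega -> R) \in Lfun P 1 by rewrite Lfun_cst.
have b1 : b \o* D \in Lfun P 1 by rewrite Lfun_scale.
have c1 : c \o* (D \* D) \in Lfun P 1 by rewrite Lfun_scale.
rewrite !expectationD ?rpredD//.
by rewrite expectation_cst !expectationZl// ED mule0 adde0 EDD.
Qed.

(** This settles the case [mu = 0], in which the tolerance [eps * mu] is zero and the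
    estimator is correct because the samples vanish almost surely. *)
Lemma variance0_probability_neq0 (S : Omega -> R) :
    S \in Lfun P 2%:E -> 'E_P[S]%E = 0%E -> 'V_P[S]%E = 0%E ->
  P [set w | S w != 0] = 0%E.
Proof.
move=> S2 ES VS.
have := expectation_quadratic 0 0 1 S2 ES.
have mS : measurable_fun setT S.
  by have /andP[/set_mem] := S2.
rewrite VS mule0 adde0 expectation.unlock.
have -> : (\int[P]_w (0 + 0 * (S w - 0) + 1 * (S w - 0) ^+ 2)%:E =
   \int[P]_w `| (S w ^+ 2)%:E |)%E.
  apply: eq_integral => w _; rewrite mul0r !add0r mul1r subr0.
  by rewrite /= ger0_norm// sqr_ge0.
move/ae_eq_integral_abs; case=> //.
  by apply/measurable_EFinP; exact: measurable_funX.
move=> N [mN PN SN].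
apply/eqP; rewrite eq_le measure_ge0 andbT -PN le_measure ?inE//.
  have -> : [set w | S w != 0] = setT `&` S @^-1` (~` [set 0]).
    by rewrite setTI; apply/seteqP; split => w /eqP.
  by apply: mS => //; exact: measurableC.
move=> w /= Sw; apply: SN => /=; move/(_ I) => [] /eqP; rewrite sqrf_eq0.
exact/negP.
Qed.

End moments.

Section finite_variance.
Context d (Omega : measurableType d) (R : realType) (P : probability Omega R).

Lemma finite_variance_Lfun2 (X : {RV P >-> R}) :
  ('V_P[X] < +oo)%E -> (X : Omega -> R) \in Lfun P 2%:E.
Proof.
move=> VX; set mu := fine 'E_P[X]%E.
have mD : measurable_fun setT (fun w => X w - mu) by exact: measurable_funB.
have D2 : (fun w => X w - mu) \in Lfun P 2%:E.
  apply/andP; split; rewrite inE//= /finite_norm unlock /Lnorm poweR_lty//.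
  move: VX; rewrite /variance covariance.unlock -/mu expectation.unlock.
  apply: le_lt_trans; rewrite le_eqVlt; apply/orP; left; apply/eqP.
  apply: eq_integral => w _.
  by rewrite /= powR_mulrn// real_normK ?num_real// expr2.
have -> : (X : Omega -> R) = (fun w => X w - mu) \+ cst mu.
  by apply/funext => w /=; rewrite subrK.
by rewrite rpredD ?lee1n// => ?; exact: Lfun_cst.
Qed.

Lemma std_dev_le_variance (X : {RV P >-> R}) (b : R) :
  (std_dev X <= b%:E)%E -> ('V_P[X] <= (b ^+ 2)%:E)%E.
Proof.
rewrite /std_dev => sb; rewrite -(sqr_sqrte (variance_ge0 P X)).
have : (0 <= sqrte 'V_P[X])%E by exact: sqrte_ge0.
move: sb; case: (sqrte _) => [s| |]; rewrite ?leye_eq// -EFin_expe !lee_fin.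
by move=> sb s0; rewrite lerXn2r// nnegrE (le_trans s0).
Qed.

End finite_variance.

Section block_means.
Context d (Omega : measurableType d) (R : realType) (P : probability Omega R).
Context (m : nat) (X : 'I_m -> {RV P >-> R}) (mu s : R).
Hypothesis m_gt0 : (0 < m)%N.
Hypothesis X2 : forall i, (X i : Omega -> R) \in Lfun P 2%:E.
Hypothesis EX : forall i, 'E_P[X i]%E = mu%:E.
Hypothesis VX : forall i, ('V_P[X i] <= (s ^+ 2)%:E)%E.
Hypothesis indX : forall i j, i != j -> independent2 P (X i) (X j).

Local Notation mean := (m%:R^-1 \o* (\sum_i (X i : Omega -> R))).

Let sum2 : \sum_i (X i : Omega -> R) \in Lfun P 2%:E.
Proof. by rewrite rpred_sum ?lee1n. Qed.

Let Pfin : P [set: Omega] \is a fin_num. Proof. exact: fin_num_measure. Qed.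

Lemma sample_mean_Lfun2 : mean \in Lfun P 2%:E.
Proof. by rewrite Lfun_scale// ler1n. Qed.

Lemma expectation_sample_mean : 'E_P[mean]%E = mu%:E.
Proof.
rewrite expectationZl; last exact: Lfun_subset12.
have -> : \sum_i (X i : Omega -> R) = \sum_(Y <- [seq (X i : Omega -> R) | i <- enum 'I_m]) Y.
  by rewrite big_map big_enum.
rewrite expectation_sum; last first.
  by move=> _ /mapP[i _ ->]; exact: Lfun_subset12.
rewrite big_map big_enum/= (eq_bigr (fun=> mu%:E))//.
rewrite sumEFin sumr_const card_ord -EFinM -[mu *+ m]mulr_natl mulrA mulVf ?mul1r//.
by rewrite pnatr_eq0 -lt0n.
Qed.

Lemma variance_sample_mean : ('V_P[mean] <= (s ^+ 2 / m%:R)%:E)%E.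
Proof.
rewrite varianceZ//.
rewrite (variance_sum_uncorrelated (index_enum_uniq _))//; last first.
  move=> i j /indX ij; rewrite covarianceE ?Lfun2_mul_Lfun1// ?Lfun_subset12//.
  rewrite (independent2_expectationM (X2 i) (X2 j) ij) subee//.
  by rewrite !EX.
apply: (@le_trans _ _ ((m%:R^-1 ^+ 2)%:E * \sum_(i < m) (s ^+ 2)%:E)%E).
  rewrite lee_pmul2l//; first exact: lee_sum.
  by rewrite lte_fin exprn_gt0// invr_gt0 ltr0n.
rewrite sumEFin sumr_const card_ord -EFinM lee_fin -[s ^+ 2 *+ m]mulr_natl.
rewrite le_eqVlt; apply/orP; left; apply/eqP; field.
by rewrite pnatr_eq0 -lt0n.
Qed.

End block_means.

(** * Measurability of threshold events *)

Section measurable_tails.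
Context d (T : measurableType d) (R : realType) (f : T -> R).
Hypothesis mf : measurable_fun setT f.

Lemma measurable_gt_cst (y : R) : measurable [set w | y < f w].
Proof.
rewrite -[X in measurable X]setTI.
exact: (measurable_fun_ltr (measurable_cst y) mf measurableT (Y := [set true])).
Qed.

Lemma measurable_lt_cst (y : R) : measurable [set w | f w < y].
Proof.
rewrite -[X in measurable X]setTI.
exact: (measurable_fun_ltr mf (measurable_cst y) measurableT (Y := [set true])).
Qed.

End measurable_tails.

Lemma measurable_count_ge d (T : measurableType d) (n k : nat)
    (B : 'I_n -> set T) : (forall j, measurable (B j)) ->
  measurable [set w | (k <= \sum_j (w \in B j : nat))%N].
Proof.
move=> mB.
have countE (A : {set 'I_n}) : #|A| = (\sum_j (j \in A : nat))%N.
  by rewrite -sum1_card big_mkcond; apply: eq_bigr => j _; case: ifP.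
have -> : [set w | (k <= \sum_j (w \in B j : nat))%N] =
    \bigcup_(A in [set A : {set 'I_n} | (k <= #|A|)%N])
      \bigcap_(j in [set j | j \in A]) B j.
  apply/seteqP; split => [w kw|w [A kA BA]].
    exists [set j | w \in B j]%SET => [|j /=]; last by rewrite inE => /set_mem.
    by rewrite /= countE; under eq_bigr do rewrite inE.
  apply: (leq_trans kA); rewrite countE; apply: leq_sum => j _.
  by case: (boolP (j \in A)) => // jA; rewrite mem_set//; exact: BA.
apply: fin_bigcup_measurable => [|A _]; first exact: finite_finset.
by apply: fin_bigcap_measurable => [|j _]; first exact: finite_finset.
Qed.

(** * Smoothing *)

Section counting.
Context (R : realType).

Lemma sum_ord_lt_le (N : nat) (b : R) : 0 <= b ->
  \sum_(i < N) ((i%:R < b)%R : nat)%:R <= b + 1.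
Proof.
move=> b0; elim: N => [|N IHN]; first by rewrite big_ord0 addr_ge0.
have [bN|Nb] := leP b N%:R.
  by rewrite big_ord_recr/= ltNge bN addr0.
rewrite (@le_trans _ _ N.+1%:R)//; last by rewrite -natr1 lerD2r ltW.
rewrite -[X in _ <= X%:R]card_ord -sumr_const.
by apply: ler_sum => i _; rewrite lern1 leq_b1.
Qed.

(** A uniform random point of this equidistant grid stands for a uniform random real
    of [1 - eps, 1 + eps], so that the auxiliary randomness is finite. *)
Definition grid_shift (eps : R) (N : nat) (i : 'I_N.+1) : R :=
  1 - eps + 2 * eps * (i%:R / N.+1%:R).

(** A quadratic function above the positive part of [x], from
    [`|x| <= x ^+ 2 / (2 * a) + a / 2]. Integrating it gives
    [E[x^+] <= a / 2] for a centred variable of standard deviation at most [a],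
    without any use of absolute moments. *)
Definition pos_part_majorant (a x : R) : R := x / 2 + x ^+ 2 / (4 * a) + a / 4.

Lemma pos_part_majorant_ge0 (a x : R) : 0 < a -> 0 <= pos_part_majorant a x.
Proof.
move=> a0; rewrite /pos_part_majorant.
have -> : x / 2 + x ^+ 2 / (4 * a) + a / 4 = (x + a) ^+ 2 / (4 * a).
  by field; rewrite gt_eqF.
by rewrite divr_ge0 ?sqr_ge0// mulr_ge0// ltW.
Qed.

Lemma pos_part_majorant_ge (a x : R) : 0 < a -> x <= pos_part_majorant a x.
Proof.
move=> a0; rewrite /pos_part_majorant -subr_ge0.
have -> : x / 2 + x ^+ 2 / (4 * a) + a / 4 - x = (x - a) ^+ 2 / (4 * a).
  by field; rewrite gt_eqF.
by rewrite divr_ge0 ?sqr_ge0// mulr_ge0// ltW.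
Qed.

(** For [mu <= s] the proportion of [v] in [1 - eps, 1 + eps] with
    [(1 + eps) * mu < v * s] is at most [(1 + eps) * (1 - mu / s) / (2 * eps)], and
    [1 - mu / s <= s / mu - 1]. The last [+ 1] allows for the discretization. *)
Lemma count_shift_gt (eps mu s : R) (N : nat) :
    0 < eps -> eps < 1 -> 0 < mu -> mu <= s ->
  \sum_(i < N.+1) (((1 + eps) * mu < grid_shift eps i * s)%R : nat)%:R <=
    N.+1%:R * ((1 + eps) / (2 * eps * mu)) * (s - mu) + 1.
Proof.
move=> e0 e1 mu0 mus; have s0 : 0 < s by exact: lt_le_trans mus.
(* Counting from the largest grid point, the condition implies [i < b]. *)
rewrite (reindex_inj rev_ord_inj)/=.
pose b := N.+1%:R * ((1 + eps) / (2 * eps * s)) * (s - mu).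
apply: (@le_trans _ _ (b + 1)); last first.
  rewrite lerD2r ler_wpM2r ?subr_ge0// ler_wpM2l// ler_wpM2l//; first lra.
  by rewrite lef_pV2 ?posrE ?mulr_gt0// ler_pM2l ?mulr_gt0.
have b0 : 0 <= b.
  by rewrite mulr_ge0 ?subr_ge0// mulr_ge0// divr_ge0 ?mulr_ge0 ?ltW//; lra.
apply: le_trans (sum_ord_lt_le N.+1 b0).
apply: ler_sum => i _; rewrite ler_nat; case: ltP => //= +; rewrite /grid_shift/=.
have -> : (N.+1 - i.+1)%:R = N.+1%:R - i%:R - 1 :> R.
  by rewrite natrB// -[i.+1%:R]natr1 opprD addrA.
set M : R := N.+1%:R; have M0 : 0 < M by rewrite ltr0n.
move=> H; rewrite lt0b /b -/M.
have -> : M * ((1 + eps) / (2 * eps * s)) * (s - mu) =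
    (M * (1 + eps) * (s - mu)) / (2 * eps * s).
  by field; rewrite !gt_eqF.
rewrite ltr_pdivlMr ?mulr_gt0//.
have : (1 + eps) * mu * M < (1 - eps + 2 * eps * ((M - i%:R - 1) / M)) * s * M.
  by rewrite ltr_pM2r.
have -> : (1 - eps + 2 * eps * ((M - i%:R - 1) / M)) * s * M =
    ((1 + eps) * M - 2 * eps * (i%:R + 1)) * s.
  by field; rewrite gt_eqF.
have := mulr_gt0 e0 s0; nra.
Qed.

(** For [s <= mu] the proportion of [v] in [1 - eps, 1 + eps] with
    [v * s < (1 - eps) * mu] is convex in [s] until it reaches 1, at
    [s = mu * (1 - eps) / (1 + eps)]; so it lies below the chord joining this
    point to [s = mu], which has slope [- (1 + eps) / (2 * eps * mu)]. *)
Lemma count_shift_lt (eps mu s : R) (N : nat) :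
    0 < eps -> eps < 1 -> 0 < mu -> s <= mu ->
  \sum_(i < N.+1) ((grid_shift eps i * s < (1 - eps) * mu)%R : nat)%:R <=
    N.+1%:R * ((1 + eps) / (2 * eps * mu)) * (mu - s) + 1.
Proof.
move=> e0 e1 mu0 smu; set M : R := N.+1%:R; have M0 : 0 < M by rewrite ltr0n.
(* In the first case the bound exceeds the total number of grid points. *)
have [sl|sg] := leP ((1 + eps) * s) ((1 - eps) * mu).
  apply: (@le_trans _ _ M).
    rewrite /M -[X in _ <= X%:R]card_ord -sumr_const.
    by apply: ler_sum => i _; rewrite lern1 leq_b1.
  apply: (@le_trans _ _ (M * 1)); first by rewrite mulr1.
  rewrite -[leLHS]addr0 lerD// -mulrA ler_wpM2l ?(ltW M0)//.
  rewrite mulrAC ler_pdivlMr ?mulr_gt0// mul1r; nra.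
have s0 : 0 < s.
  by rewrite -(pmulr_rgt0 s (_ : 0 < 1 + eps)); [|lra];
    apply: le_lt_trans sg; rewrite mulr_ge0//; lra.
pose b := M * ((1 - eps) / (2 * eps * s)) * (mu - s).
apply: (@le_trans _ _ (b + 1)); last first.
  rewrite lerD2r ler_wpM2r ?subr_ge0// ler_wpM2l ?ltW//.
  rewrite ltr_pdivrMr ?mulr_gt0// mulrAC ltr_pdivlMr ?mulr_gt0//.
  by have := mulr_gt0 e0 s0; have := mulr_gt0 e0 mu0; nra.
have b0 : 0 <= b.
  by rewrite mulr_ge0 ?subr_ge0// mulr_ge0 ?divr_ge0 ?mulr_ge0 ?ltW//; lra.
apply: le_trans (sum_ord_lt_le N.+1 b0).
apply: ler_sum => i _; rewrite ler_nat; case: ltP => //= +; rewrite /grid_shift/= -/M.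
move=> H; rewrite lt0b /b.
have -> : M * ((1 - eps) / (2 * eps * s)) * (mu - s) =
    (M * (1 - eps) * (mu - s)) / (2 * eps * s).
  by field; rewrite !gt_eqF.
rewrite ltr_pdivlMr ?mulr_gt0//.
have : (1 - eps + 2 * eps * (i%:R / M)) * s * M < (1 - eps) * mu * M.
  by rewrite ltr_pM2r.
have -> : (1 - eps + 2 * eps * (i%:R / M)) * s * M =
    ((1 - eps) * M + 2 * eps * i%:R) * s.
  by field; rewrite gt_eqF.
nra.
Qed.

End counting.

Section smoothed_tails.
Context d (Omega : measurableType d) (R : realType) (P : probability Omega R).
Context (S : {RV P >-> R}) (eps mu : R) (N : nat).
Hypotheses (eps_gt0 : 0 < eps) (eps_lt1 : eps < 1).
Hypothesis N_large : 4 <= N.+1%:R * eps ^+ 2.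
Hypotheses (S2 : (S : Omega -> R) \in Lfun P 2%:E) (ES : ('E_P[S] = mu%:E)%E).
Hypothesis VS : ('V_P[S] <= ((eps * mu * (1 - eps)) ^+ 2)%:E)%E.

(** Both tails follow from this bound, with [t = 1] and [t = -1]. Since
    [a = eps * mu * (1 - eps)] bounds the standard deviation, the average over the
    grid is at most [(1 + eps) / (2 * eps * mu) * (a / 2) = (1 - eps ^+ 2) / 4],
    up to the discretization error [1 / N.+1], which the gap to [1 / 4] absorbs. *)
Let average_le (A : 'I_N.+1 -> set Omega) (t : R) :
    0 < mu -> (forall i, measurable (A i)) -> t ^+ 2 = 1 ->
    (forall w, 0 <= t * (S w - mu) -> \sum_i (\1_(A i) w : R) <=
       N.+1%:R * ((1 + eps) / (2 * eps * mu)) * (t * (S w - mu)) + 1) ->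
    (forall w, t * (S w - mu) < 0 -> \sum_i (\1_(A i) w : R) = 0) ->
  (\sum_i P (A i) <= (N.+1%:R / 4)%:E)%E.
Proof.
move=> mu0 mA t2 Apos Aneg.
move: N_large VS Apos; set M : R := N.+1%:R => N4 VSa Apos.
have M0 : 0 < M by rewrite ltr0n.
set k := (1 + eps) / (2 * eps * mu) in Apos.
have k0 : 0 < k by rewrite divr_gt0 ?mulr_gt0 ?addr_gt0//.
set a := eps * mu * (1 - eps) in VSa.
have a0 : 0 < a by rewrite !mulr_gt0// subr_gt0.
pose g w := (1 + M * k * a / 4) + (M * k * t / 2) * (S w - mu) +
  (M * k / (4 * a)) * (S w - mu) ^+ 2.
have gE w : g w = M * k * pos_part_majorant a (t * (S w - mu)) + 1.
  rewrite /g /pos_part_majorant exprMn t2 mul1r; field.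
  by rewrite gt_eqF.
have Mk0 : 0 <= M * k by rewrite ltW// mulr_gt0.
have Ag w : \sum_i 1 * (\1_(A i) w : R) <= g w.
  under eq_bigr do rewrite mul1r.
  rewrite gE; have [xn|xp] := ltP (t * (S w - mu)) 0.
    by rewrite Aneg// addr_ge0// mulr_ge0// pos_part_majorant_ge0.
  by apply: le_trans (Apos _ xp) _; rewrite lerD2r ler_wpM2l// pos_part_majorant_ge.
have mg : measurable_fun setT g.
  have mSmu : measurable_fun setT (fun w => S w - mu).
    by apply: measurable_funB.
  apply: measurable_funD; last first.
    by apply: measurable_funM => //; exact: measurable_funX.
  by apply: measurable_funD => //; exact: measurable_funM.
have := sum_probability_le_expectation P mA (fun=> ler01) mg Ag.
under eq_bigr do rewrite mul1e.
move=> /le_trans; apply.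
rewrite /g (expectation_quadratic _ _ _ S2 ES).
have Vfin := variance_fin_num S2.
move: VSa; rewrite -(fineK Vfin) lee_fin -EFinM -EFinD lee_fin => Va.
set V := fine _ in Va *.
apply: (@le_trans _ _ (1 + M * k * a / 4 + M * k / (4 * a) * a ^+ 2)).
  by rewrite lerD2l ler_wpM2l// divr_ge0// mulr_ge0// ltW.
have -> : 1 + M * k * a / 4 + M * k / (4 * a) * a ^+ 2 =
    1 + M / 4 - (M * eps ^+ 2) / 4.
  by rewrite /k /a; field; rewrite !gt_eqF// subr_gt0.
lra.
Qed.

Let mshift i : measurable_fun setT (fun w => @grid_shift R eps N i * S w).
Proof. by apply: measurable_funM. Qed.

Let shift_bounds i : 1 - eps <= @grid_shift R eps N i <= 1 + eps.
Proof.
have : 0 <= (i%:R / N.+1%:R : R) <= 1.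
  by rewrite divr_ge0//= ler_pdivrMr ?ltr0n// mul1r ler_nat ltnW.
rewrite /grid_shift; move: (_ / _) => q /andP[q0 q1].
have eq0 : 0 <= eps * q by rewrite mulr_ge0// ltW.
have eq1 : eps * q <= eps by rewrite ler_piMr// ltW.
by apply/andP; split; lra.
Qed.

Let measurable_neq0 : measurable [set w | S w != 0].
Proof.
have -> : [set w | S w != 0] = setT `&` S @^-1` (~` [set 0]).
  by rewrite setTI; apply/seteqP; split => w /eqP.
by apply: measurable_funPT => //; exact: measurableC.
Qed.

(* For [mu = 0] both tail events lie in [S != 0]. *)
Let probability_neq0 : mu = 0 -> P [set w | S w != 0] = 0%E.
Proof.
move=> mu0; apply: variance0_probability_neq0 => //; first by rewrite ES mu0.
apply/eqP; rewrite eq_le variance_ge0 andbT.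
by move: VS; rewrite mu0 mulr0 mul0r expr0n.
Qed.

Lemma smoothed_upper_tail : 0 <= mu ->
  (\sum_i P [set w | ((1 + eps) * mu < @grid_shift R eps N i * S w)%R]
    <= (N.+1%:R / 4)%:E)%E.
Proof.
rewrite le_eqVlt => /predU1P[/esym mu0|mu0].
  rewrite big1 ?lee_fin ?divr_ge0// => i _.
  apply/eqP; rewrite eq_le measure_ge0 andbT -probability_neq0//.
  rewrite le_measure ?inE//.
  - exact: measurable_gt_cst.
  - move=> w /=; rewrite mu0 mulr0; apply: contraTneq => ->.
    by rewrite mulr0 ltxx.
apply: (@average_le _ 1) => //.
- by move=> i; exact: measurable_gt_cst.
- exact: expr1n.
- move=> w; rewrite mul1r subr_ge0 => muS.
  by under eq_bigr do rewrite indicE mem_setE/=; exact: count_shift_gt.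
- move=> w; rewrite mul1r subr_lt0 => Smu; apply: big1 => i _.
  rewrite indicE memNset//=; apply/negP; rewrite -leNgt.
  have /andP[v0 v1] := shift_bounds i; have := eps_lt1; nra.
Qed.

Lemma smoothed_lower_tail : 0 <= mu ->
  (\sum_i P [set w | (@grid_shift R eps N i * S w < (1 - eps) * mu)%R]
    <= (N.+1%:R / 4)%:E)%E.
Proof.
rewrite le_eqVlt => /predU1P[/esym mu0|mu0].
  rewrite big1 ?lee_fin ?divr_ge0// => i _.
  apply/eqP; rewrite eq_le measure_ge0 andbT -probability_neq0//.
  rewrite le_measure ?inE//.
  - exact: measurable_lt_cst.
  - move=> w /=; rewrite mu0 mulr0; apply: contraTneq => ->.
    by rewrite mulr0 ltxx.
apply: (@average_le _ (-1)) => //.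
- by move=> i; exact: measurable_lt_cst.
- by rewrite sqrrN expr1n.
- move=> w; rewrite mulN1r opprB subr_ge0 => Smu.
  by under eq_bigr do rewrite indicE mem_setE/=; exact: count_shift_lt.
- move=> w; rewrite mulN1r opprB subr_lt0 => muS; apply: big1 => i _.
  rewrite indicE memNset//=; apply/negP; rewrite -leNgt.
  have /andP[v0 v1] := shift_bounds i; have := eps_lt1; nra.
Qed.

End smoothed_tails.

(** * Majority votes and order statistics *)

Section chernoff.
Context d (Omega : measurableType d) (R : realType) (P : probability Omega R).

(** Markov inequality for [3 ^+ Y], where [Y] is the number of events that occur.
    Expanding [3 ^+ Y = \prod_j (1 + 2 * \1_(B j))] over subsets of indices
    reduces its expectation to probabilities of intersections. *)
Lemma majority_bound (n k : nat) (B : 'I_n -> set Omega) :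
    (forall j, measurable (B j)) ->
    (forall A : {set 'I_n}, P (\bigcap_j (if j \in A then B j else setT)) =
       (\prod_j P (if j \in A then B j else setT))%E) ->
  3 ^+ k * fine (P [set w | (k <= \sum_j ((w \in B j) : nat))%N]) <=
    \prod_j (1 + 2 * fine (P (B j))) :> R.
Proof.
move=> mB indB.
(* [F A] and [c A] are the event and the coefficient of the subset [A]. *)
pose F (A : {set 'I_n}) : set Omega := \bigcap_j (if j \in A then B j else setT).
pose c (A : {set 'I_n}) : R := \prod_j (if j \in A then 2 else 1).
have mF A : measurable (F A).
  apply: fin_bigcap_measurable => [|j _]; first exact: finite_finset.
  by case: ifP.
have c0 A : 0 <= c A by apply: prodr_ge0 => j _; case: ifP.
pose E := [set w | (k <= \sum_j (w \in B j))%N].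
have FE A w : \1_(F A) w = \prod_j (if j \in A then \1_(B j) w else 1) :> R.
  apply/esym; rewrite indicE; case: (asboolP (F A w)) => Fw.
    rewrite mem_set//; apply: big1 => j _; case: ifPn => // jA.
    by rewrite indicE mem_set//; have := Fw j I; rewrite jA.
  rewrite memNset//; apply/eqP/prodf_eq0 => /=.
  have /existsNP[j /not_implyP[_]] : ~ F A w by [].
  case: ifPn => [jA Bj|_ /(_ I)//]; exists j => //.
  by rewrite jA indicE memNset.
have sumF (v : Omega) : \sum_A c A * (\1_(F A) v : R) =
    \prod_j (2 * \1_(B j) v + 1) :> R.
  rewrite bigA_distr; apply: eq_big => [A|A _]; first by rewrite inE.
  rewrite FE -big_split/=; apply: eq_bigr => j _.
  by case: ifP => _; rewrite ?mulr1.
have mE : measurable E by exact: measurable_count_ge.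
have mg : measurable_fun setT (fun w => \sum_A c A * (\1_(F A) w : R)).
  apply: measurable_sum => A.
  by apply: measurable_funM => //; exact: measurable_indic.
have Eg w : \sum_(i : 'I_1) 3 ^+ k * (\1_E w : R) <= \sum_A c A * \1_(F A) w.
  rewrite big_ord1 sumF indicE; case: (asboolP (E w)) => Ew; last first.
    rewrite memNset// mulr0; apply: prodr_ge0 => j _.
    by rewrite addr_ge0// mulr_ge0.
  rewrite mem_set// mulr1.
  have -> : \prod_j (2 * (\1_(B j) w : R) + 1) = 3 ^+ (\sum_j (w \in B j)).
    rewrite -prodrXr; apply: eq_bigr => j _; rewrite indicE.
    by case: (_ \in _) => /=; ring.
  by rewrite ler_eXn2l// ltr1n.
have c3 : forall _ : 'I_1, 0 <= 3 ^+ k :> R by move=> _; rewrite exprn_ge0.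
have := sum_probability_le_expectation P (fun=> mE) c3 mg Eg.
rewrite big_ord1 expectation_sum_indic//.
have PF A : ((c A)%:E * P (F A) =
    (\prod_j (if j \in A then 2 * fine (P (B j)) else 1))%:E)%E.
  rewrite indB -!prodEFin -big_split/=; apply: eq_bigr => j _.
  case: ifP => _; last by rewrite probability_setT mul1e.
  by rewrite EFinM fineK// fin_num_measure.
rewrite (eq_bigr _ (fun A _ => PF A)).
rewrite sumEFin -/E -(fineK (fin_num_measure P _ mE)) -EFinM lee_fin.
move=> /le_trans; apply; rewrite le_eqVlt; apply/orP; left; apply/eqP.
under [RHS]eq_bigr do rewrite addrC.
by rewrite bigA_distr; apply: eq_bigl => A; rewrite inE.
Qed.

End chernoff.

Section order_statistics.
Context (disp : Order.disp_t) (T : orderType disp) (x0 : T).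
Implicit Types (s : seq T) (p : pred T).

Definition order_statistic (k : nat) s : T := nth x0 (sort <=%O s) k.

Lemma count_down_closed k s p : (k < size s)%N ->
    (forall x y, (x <= y)%O -> p y -> p x) ->
  p (order_statistic k s) -> (k < count p s)%N.
Proof.
rewrite /order_statistic -(count_sort <=%O) -(size_sort <=%O).
have := sort_sorted (@le_total _ T) s.
move: (sort _ _) => {s}s s_sorted ks pdown pk.
have all_take : all p (take k.+1 s).
  apply/(all_nthP x0) => i; rewrite size_takel// ltnS => ik.
  rewrite nth_take//; apply: pdown pk.
  apply: (sorted_leq_nth le_trans le_refl) => //.
  by rewrite inE (leq_ltn_trans ik).
rewrite -(cat_take_drop k.+1 s) count_cat.
by move: all_take; rewrite all_count => /eqP ->; rewrite size_takel// leq_addr.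
Qed.

Lemma count_up_closed k s p : (k < size s)%N ->
    (forall x y, (x <= y)%O -> p x -> p y) ->
  p (order_statistic k s) -> (size s - k <= count p s)%N.
Proof.
rewrite /order_statistic -(count_sort <=%O) -(size_sort <=%O).
have := sort_sorted (@le_total _ T) s.
move: (sort _ _) => {s}s s_sorted ks pup pk.
have all_drop : all p (drop k s).
  apply/(all_nthP x0) => i; rewrite size_drop ltn_subRL => ik.
  rewrite nth_drop; apply: pup pk.
  by apply: (sorted_leq_nth le_trans le_refl) => //; rewrite leq_addr.
rewrite -[in leqRHS](cat_take_drop k s) count_cat -size_drop.
by move: all_drop; rewrite all_count => /eqP ->; rewrite leq_addl.
Qed.

End order_statistics.

Section measurable_order_statistic.
Context d (T : measurableType d) (R : realType) (n : nat) (f : 'I_n -> T -> R).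
Hypothesis mf : forall j, measurable_fun setT (f j).

Lemma count_enum (p : pred R) (x : 'I_n -> R) :
  count p [seq x j | j <- enum 'I_n] = (\sum_j (p (x j)))%N.
Proof.
rewrite count_map -sum1_count big_enum_cond/= big_mkcond/=.
by apply: eq_bigr => j _; case: ifP.
Qed.

Lemma lt_order_statistic k (y : R) (x : 'I_n -> R) : (k < n)%N ->
  (y < order_statistic 0 k [seq x j | j <- enum 'I_n]) =
  (n - k <= \sum_j (y < x j)%R)%N.
Proof.
move=> kn; set s := [seq x j | j <- enum 'I_n].
have sz : size s = n by rewrite size_map size_enum_ord.
apply/idP/idP => [yos|].
  rewrite -[X in (X - _ <= _)%N]sz -(count_enum (fun x => y < x)).
  apply: count_up_closed yos; first by rewrite sz.
  by move=> u v uv yu; exact: lt_le_trans uv.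
move=> many; rewrite ltNge; apply/negP => osy; move: many.
rewrite -(count_enum (fun x => y < x)) -/s.
have : (k < count (fun x => (x <= y)%R) s)%N.
  apply: count_down_closed osy; first by rewrite sz.
  by move=> u v uv; exact: le_trans.
have := count_predC (fun x => (x <= y)%R) s.
have /eq_count -> : predC (fun x => (x <= y)%R) =1 (fun x => (y < x)%R).
  by move=> u /=; rewrite -ltNge.
rewrite sz.
by move=> <- kc; rewrite leq_subLR leq_add2r leqNgt kc.
Qed.

Lemma order_statistic_lt k (y : R) (x : 'I_n -> R) : (k < n)%N ->
  (order_statistic 0 k [seq x j | j <- enum 'I_n] < y) =
  (k < \sum_j (x j < y)%R)%N.
Proof.
move=> kn; set s := [seq x j | j <- enum 'I_n].
have sz : size s = n by rewrite size_map size_enum_ord.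
rewrite -(count_enum (fun x => x < y)) -/s; apply/idP/idP => [osy|].
  apply: count_down_closed osy; first by rewrite sz.
  by move=> u v uv; exact: le_lt_trans.
move=> many; rewrite ltNge; apply/negP => yos; move: many.
have : (n - k <= count (fun x => (y <= x)%R) s)%N.
  rewrite -sz; apply: count_up_closed yos; first by rewrite sz.
  by move=> u v uv yu; exact: le_trans uv.
have := count_predC (fun x => (y <= x)%R) s.
have /eq_count -> : predC (fun x => (y <= x)%R) =1 (fun x => (x < y)%R).
  by move=> u /=; rewrite -ltNge.
by rewrite sz => <-; rewrite leq_subLR addnC leq_add2r leqNgt => /negbTE ->.
Qed.

Lemma measurable_order_statistic k : (k < n)%N ->
  measurable_fun setT (fun w => order_statistic 0 k [seq f j w | j <- enum 'I_n]).
Proof.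
move=> kn; apply: (measurability _ (RGenOInfty.measurableE R)) => //.
move=> _ [_ [y ->] <-]; rewrite setTI.
have -> : (fun w => order_statistic 0 k [seq f j w | j <- enum 'I_n]) @^-1` `]y, +oo[ =
    [set w | (n - k <= \sum_j (w \in [set v | (y < f j v)%R] : nat))%N].
  apply/funext => w; rewrite /= in_itv/= andbT lt_order_statistic//.
  by congr (is_true (_ <= _)%N); apply: eq_bigr => j _; rewrite mem_setE.
by apply: measurable_count_ge => j; exact: measurable_gt_cst.
Qed.

End measurable_order_statistic.

(** * The estimator *)

Section uniform_law.
Context (R : realType) (K : nat).

Definition uniform_law : set nat -> \bar R :=
  mscale (K.+1%:R^-1)%:nng (msum (fun u : nat => \d_u) K.+1).

HB.instance Definition _ := Measure.on uniform_law.

Lemma uniform_lawE (A : set nat) :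
  uniform_law A = (K.+1%:R^-1 * \sum_(u < K.+1) ((u : nat) \in A)%:R)%:E.
Proof.
rewrite /uniform_law /mscale/= /msum EFinM -sumEFin.
by congr (_ * _)%E; apply: eq_bigr => u _; rewrite diracE.
Qed.

Let uniform_law_setT : uniform_law setT = 1%E.
Proof.
rewrite uniform_lawE; under eq_bigr do rewrite in_setT.
by rewrite sumr_const card_ord mulVf// pnatr_eq0.
Qed.

HB.instance Definition _ :=
  Measure_isProbability.Build _ _ _ uniform_law uniform_law_setT.

(** Conditioning on the value of [U]: the values above [K] have probability zero,
    and subadditivity collects the others. *)
Lemma independent_uniform_mixture d (Omega : measurableType d)
    (P : probability Omega R) d' (T : measurableType d')
    (Z : Omega -> T) (U : {RV P >-> nat}) (D : nat -> set T) :
    measurable_fun setT Z -> (forall u, measurable (D u)) ->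
    has_distribution U uniform_law -> independent2 P Z U ->
  (P [set w | D (U w) (Z w)] <=
    \sum_(u < K.+1) (K.+1%:R^-1)%:E * P (Z @^-1` D u))%E.
Proof.
move=> mZ mD distU indZU.
pose F (u : nat) := Z @^-1` D u `&` U @^-1` [set u].
have mZD u : measurable (Z @^-1` D u).
  by rewrite -[X in measurable X]setTI; exact: mZ.
have mU A : measurable (U @^-1` A).
  by rewrite -[X in measurable X]setTI; exact: measurable_funPT.
have mF u : measurable (F u) by exact: measurableI.
pose out := U @^-1` [set u | (K < u)%N].
have -> : [set w | D (U w) (Z w)] = \bigcup_u F u.
  apply/seteqP; split => [w Dw|w [u _ [Zu Uu]]]; last by rewrite /= Uu.
  by exists (U w).
have PU (A : set nat) : P (U @^-1` A) =
    (K.+1%:R^-1 * \sum_(u < K.+1) ((u : nat) \in A)%:R)%:E.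
  by rewrite -uniform_lawE; exact: distU.
have out0 : P out = 0%E.
  rewrite PU big1 ?mulr0// => u _.
  by rewrite memNset//=; apply/negP; rewrite -leqNgt -ltnS.
have FE u : (u < K.+1)%N -> P (F u) = ((K.+1%:R^-1)%:E * P (Z @^-1` D u))%E.
  move=> uK; rewrite indZU//= muleC; congr (_ * _)%E.
  rewrite PU (bigD1 (Ordinal uK))//= mem_set// big1 ?addr0 ?mulr1//.
  move=> v vu; rewrite memNset//= => vE; move/eqP : vu; apply.
  exact/val_inj.
apply: (@le_trans _ _ (P (out `|` \big[setU/set0]_(u < K.+1) F u))).
  apply: le_measure; rewrite ?inE.
  - exact: bigcupT_measurable.
  - by apply: measurableU; [exact: mU | exact: bigsetU_measurable].
  - move=> w [u _ [Zu Uu]]; have [uK|Ku] := ltnP u K.+1.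
      by right; rewrite -bigcup_mkord; exists u.
    by left; rewrite /out/= Uu.
apply: le_trans (measureU2 _ _ _) _; first exact: mU.
  exact: bigsetU_measurable.
rewrite [X in (X + _ <= _)%E]out0 add0e.
apply: le_trans (Boole_inequality _ _) _ => //.
by apply: lee_sum => u _; have <- := FE u (ltn_ord u).
Qed.

End uniform_law.

Section estimator.
Context (R : realType) (m k N : nat) (eps : R).
Local Notation n := (2 * k + 1)%N.

(** The samples are arranged as the entries of an [m] by [2 * k + 1] matrix, whose
    columns are the blocks. *)
Definition block_mean (j : 'I_n) (x : (m * n).-tuple R) : R :=
  m%:R^-1 * \sum_(i < m) tnth x (mxvec_index i j).

(** Independent grid points for all blocks amount to one uniform function from
    blocks to grid points, which is coded by its rank. *)
Definition shift_choice (u : nat) : {ffun 'I_n -> 'I_N.+1} :=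
  nth [ffun=> ord0] (enum {ffun 'I_n -> 'I_N.+1}) u.

(** Counting from 0, the order statistic [k] of [2 * k + 1] values is their median;
    the argument 0 of [order_statistic] is a default value that is never reached. *)
Definition smoothed_median (z : ((m * n).-tuple R * nat)%type) : R :=
  order_statistic 0 k
    [seq grid_shift eps (shift_choice z.2 j) * block_mean j z.1 | j <- enum 'I_n].

Lemma measurable_block_mean j : measurable_fun setT (block_mean j).
Proof.
apply: measurable_funM => //; apply: measurable_sum => i.
exact: measurable_tnth.
Qed.

Lemma measurable_smoothed_median : measurable_fun setT smoothed_median.
Proof.
apply: (@measurable_order_statistic _ _ _ _
  (fun j z => grid_shift eps (shift_choice z.2 j) * block_mean j z.1)); last lia.
move=> j; apply: measurable_funM.
  have mg : measurable_fun setT (fun u : nat => @grid_shift R eps N (shift_choice u j)).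
    by [].
  exact: (measurableT_comp mg).
exact: (measurableT_comp (measurable_block_mean j)).
Qed.

HB.instance Definition _ :=
  isMeasurableFun.Build _ _ _ _ smoothed_median measurable_smoothed_median.

Definition smoothed_median_estimator : randomized_estimator R (m * n) :=
  RandomizedEstimator
    (uniform_law R #|{ffun 'I_n -> 'I_N.+1}|.-1) smoothed_median.

End estimator.

(** * Concentration of the smoothed median *)

Section majority_of_smoothed_blocks.
Context d (Omega : measurableType d) (R : realType) (P : probability Omega R).
Context (m k N : nat).
Local Notation n := (2 * k + 1)%N.
Local Notation K := #|{ffun 'I_n -> 'I_N.+1}|.-1.
Context (X : nat -> {RV P >-> R}) (U : {RV P >-> nat}) (Q : 'I_N.+1 -> set R).
Hypothesis indX : mutually_independent P (fun i : nat => X i : Omega -> R).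
Hypothesis distU : has_distribution U (uniform_law R K).
Local Notation Z := (first_samples (m * n) X).
Hypothesis indXU : independent2 P Z U.
Hypothesis mQ : forall i, measurable (Q i).
Local Notation S j := (@block_mean R m k j \o Z).
Hypothesis PQ : forall j, (\sum_i P (S j @^-1` Q i) <= (N.+1%:R / 4)%:E)%E.

Let card_choices : K.+1 = (N.+1 ^ n)%N.
Proof.
have -> : K.+1 = #|{ffun 'I_n -> 'I_N.+1}|.
  by rewrite prednK//; apply/card_gt0P; exists [ffun=> ord0].
by rewrite card_ffun !card_ord.
Qed.

Let sum_choices (F : {ffun 'I_n -> 'I_N.+1} -> R) :
  \sum_(u < K.+1) F (shift_choice k N u) = \sum_r F r.
Proof.
have -> : \sum_r F r = \sum_(r <- enum {ffun 'I_n -> 'I_N.+1}) F r.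
  by rewrite big_enum.
rewrite (big_nth [ffun=> ord0]) big_mkord -cardE.
have -> // : #|{ffun 'I_n -> 'I_N.+1}| = K.+1.
by rewrite prednK//; apply/card_gt0P; exists [ffun=> ord0].
Qed.

Lemma measurable_first_samples : measurable_fun setT Z.
Proof.
apply/measurable_fun_tnthP => i.
rewrite (_ : _ \o _ = X i)//; apply/funext => w /=.
by rewrite tnth_mktuple.
Qed.

Let mS j : measurable_fun setT (S j).
Proof.
exact: (measurableT_comp (measurable_block_mean j) measurable_first_samples).
Qed.

Let mSQ j i : measurable (S j @^-1` Q i).
Proof. by rewrite -[X in measurable X]setTI; exact: mS. Qed.

Lemma block_meanE j w :
  S j w = m%:R^-1 * \sum_(i < m) X (mxvec_index i j) w.
Proof.
rewrite /= /block_mean; congr (_ * _).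
by apply: eq_bigr => i _; rewrite tnth_mktuple.
Qed.

Lemma independent_block_events (B : 'I_n -> set R) :
    (forall j, measurable (B j)) ->
  P (\bigcap_j (S j @^-1` B j)) = (\prod_j P (S j @^-1` B j))%E.
Proof.
move=> mB.
pose mean (y : m.-tuple R) := m%:R^-1 * \sum_(i < m) tnth y i.
have mmean : measurable_fun setT mean.
  apply: measurable_funM => //; apply: measurable_sum => i.
  exact: measurable_tnth.
have SE j : S j @^-1` B j = [set w |
    (mean @^-1` B j) [tuple X (mxvec_index i j) w | i < m]].
  apply/funext => w; congr (B j _); rewrite block_meanE /mean; congr (_ * _).
  by apply: eq_bigr => i _; rewrite tnth_mktuple.
rewrite (eq_bigcapr (fun j _ => SE j)) (eq_bigr _ (fun j _ => congr1 P (SE j))).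
apply: (mutually_independent_blocks indX
  (e := fun i j => mxvec_index i j : nat) (C := fun j => mean @^-1` B j)).
  by move=> [i j] [i' j'] /= /val_inj /enum_rank_inj.
by move=> j; rewrite -[X in measurable X]setTI; exact: mmean.
Qed.

(** Given the grid points, the bad events of the blocks are independent, and
    [majority_bound] applies with [3 ^+ k.+1]. Its bound is a product over blocks,
    whose average over all choices of grid points factorizes into
    [\prod_j (1 + 2 * q_j)] with [q_j <= 1 / 4] the average probability for block
    [j]; finally [3 ^- k.+1 * (3 / 2) ^+ (2 * k + 1) = (3 / 4) ^+ k / 2]. *)
Lemma majority_of_smoothed_blocks :
  (P [set w | (k < \sum_j (w \in S j @^-1` Q (shift_choice k N (U w) j) : nat))%N]
    <= ((3 / 4) ^+ k / 2)%:E)%E.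
Proof.
pose D (u : nat) := [set x | (k <
  \sum_j (x \in @block_mean R m k j @^-1` Q (shift_choice k N u j) : nat))%N].
have mD u : measurable (D u).
  apply: measurable_count_ge => j; rewrite -[X in measurable X]setTI.
  exact: (@measurable_block_mean R m k j measurableT).
pose maj (r : {ffun 'I_n -> 'I_N.+1}) :=
  [set w | (k < \sum_j (w \in S j @^-1` Q (r j) : nat))%N].
have mmaj r : measurable (maj r) by apply: measurable_count_ge.
apply: (le_trans (independent_uniform_mixture measurable_first_samples mD
  distU indXU)).
pose p r := fine (P (maj r)).
have -> : (\sum_(u < K.+1) (K.+1%:R^-1)%:E * P (Z @^-1` D u) =
    (K.+1%:R^-1 * \sum_r p r)%:E)%E.
  rewrite -sum_choices mulr_sumr -sumEFin; apply: eq_bigr => u _.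
  by rewrite EFinM fineK ?fin_num_measure.
rewrite lee_fin.
pose q j i := fine (P (S j @^-1` Q i)).
have qN j : \sum_i q j i <= N.+1%:R / 4.
  rewrite -lee_fin -sumEFin; apply: le_trans (PQ j); apply: lee_sum => i _.
  by rewrite fineK// fin_num_measure.
have q0 j i : 0 <= q j i by exact: fine_ge0.
have pr r : p r <= 3 ^- k.+1 * \prod_j (1 + 2 * q j (r j)).
  rewrite ler_pdivlMl ?exprn_gt0//.
  apply: majority_bound => // A.
  pose B j := if j \in A then Q (r j) else setT.
  have BE j : S j @^-1` B j = if j \in A then S j @^-1` Q (r j) else setT.
    by rewrite /B; case: ifP => _.
  rewrite -(eq_bigcapr (fun j _ => BE j)) -(eq_bigr _ (fun j _ => congr1 P (BE j))).
  apply: independent_block_events => j.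
  by rewrite /B; case: ifP.
apply: (@le_trans _ _ (K.+1%:R^-1 *
    (3 ^- k.+1 * \prod_(j < n) (N.+1%:R * (3 / 2))))).
  rewrite ler_wpM2l// (le_trans (ler_sum _ (fun r _ => pr r)))//.
  rewrite -mulr_sumr ler_wpM2l ?invr_ge0 ?exprn_ge0//.
  rewrite -(bigA_distr_bigA (fun j i => 1 + 2 * q j i)).
  apply: ler_prod => j _; apply/andP; split.
    by apply: sumr_ge0 => i _; rewrite addr_ge0// mulr_ge0.
  rewrite big_split/= sumr_const card_ord -mulr_sumr.
  have := qN j; lra.
rewrite prodr_const card_ord card_choices natrX exprMn.
rewrite mulrCA [X in _ * X <= _]mulrA mulVf ?expf_neq0 ?pnatr_eq0// mul1r.
rewrite exprD exprM -exprVn exprSr expr1 mulrACA -exprMn.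
rewrite le_eqVlt; apply/orP; left; apply/eqP.
by congr (_ ^+ _ * _); field.
Qed.

End majority_of_smoothed_blocks.

Section concentration.
Context d (Omega : measurableType d) (R : realType) (P : probability Omega R).
Context (m k N : nat) (eps mu s : R).
Local Notation n := (2 * k + 1)%N.
Context (X : nat -> {RV P >-> R}) (U : {RV P >-> nat}).
Hypotheses (eps_gt0 : 0 < eps) (eps_lt1 : eps < 1) (mu_ge0 : 0 <= mu).
Hypothesis N_large : 4 <= N.+1%:R * eps ^+ 2.
Hypothesis m_gt0 : (0 < m)%N.
Hypothesis m_large : s ^+ 2 / m%:R <= (eps * mu * (1 - eps)) ^+ 2.
Hypothesis indX : mutually_independent P (fun i : nat => X i : Omega -> R).
Hypothesis X2 : forall i, (X i : Omega -> R) \in Lfun P 2%:E.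
Hypothesis EX : forall i, 'E_P[X i]%E = mu%:E.
Hypothesis VX : forall i, ('V_P[X i] <= (s ^+ 2)%:E)%E.
Hypothesis distU :
  has_distribution U (uniform_law R #|{ffun 'I_n -> 'I_N.+1}|.-1).
Hypothesis indXU : independent2 P (first_samples (m * n) X) U.

(** The median is more than [eps * mu] away from [mu] only if a majority of the
    smoothed block means lies above [(1 + eps) * mu], or a majority lies below
    [(1 - eps) * mu]. *)
Lemma smoothed_median_concentration :
  (P [set w | (eps * mu <
      `| @smoothed_median R m k N eps (first_samples (m * n) X w, U w) - mu |)%R]
    <= ((3 / 4) ^+ k)%:E)%E.
Proof.
pose Z := first_samples (m * (2 * k + 1)) X.
have mZ : measurable_fun setT Z by exact: measurable_first_samples.
pose S j : {RV P >-> R} := HB.pack (@block_mean R m k j \o Z)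
  (isMeasurableFun.Build _ _ _ _ _
     (measurableT_comp (@measurable_block_mean R m k j) mZ)).
have SE j : (S j : Omega -> R) =
    m%:R^-1 \o* (\sum_(i < m) (X (mxvec_index i j) : Omega -> R)).
  apply/funext => w; apply: etrans (@block_meanE _ _ _ P m k X j w) _.
  by rewrite mulrC /= fct_sumE.
have ind_block j (i i' : 'I_m) : i != i' ->
    independent2 P (X (mxvec_index i j)) (X (mxvec_index i' j)).
  move=> ii'; apply: (mutually_independent_pair indX);
    apply: contra ii' => /eqP /= /val_inj/enum_rank_inj.
  by case=> ->.
have S2 j : (S j : Omega -> R) \in Lfun P 2%:E.
  by rewrite SE; exact: sample_mean_Lfun2.
have ES j : 'E_P[S j]%E = mu%:E.
  by rewrite SE; exact: expectation_sample_mean.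
have VS j : ('V_P[S j] <= ((eps * mu * (1 - eps)) ^+ 2)%:E)%E.
  rewrite SE; apply: (le_trans (@variance_sample_mean _ _ _ P m
    (fun i => X (mxvec_index i j)) mu s m_gt0 _ _ _ _)) => //.
  exact: ind_block.
pose W w := @smoothed_median R m k N eps (Z w, U w).
have mW : measurable_fun setT W.
  apply: (measurableT_comp (@measurable_smoothed_median R m k N eps)).
  exact: measurable_fun_pair.
have nk : (2 * k + 1 - k)%N = k.+1 by lia.
have kn : (k < 2 * k + 1)%N by lia.
have upper : (P [set w | ((1 + eps) * mu < W w)%R] <= ((3 / 4) ^+ k / 2)%:E)%E.
  pose Q i := [set s : R | (1 + eps) * mu < @grid_shift R eps N i * s].
  have mQ i : measurable (Q i).
    by apply: measurable_gt_cst; exact: mulrl_measurable.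
  apply: le_trans (majority_of_smoothed_blocks indX distU indXU mQ _); last first.
    by move=> j; exact: (smoothed_upper_tail (S := S j)).
  rewrite le_eqVlt; apply/orP; left; apply/eqP; congr (P _).
  apply/funext => w; rewrite /= /W /smoothed_median lt_order_statistic// nk.
  by congr (is_true (_ < _)%N); apply: eq_bigr => j _; rewrite mem_setE.
have lower : (P [set w | (W w < (1 - eps) * mu)%R] <= ((3 / 4) ^+ k / 2)%:E)%E.
  pose Q i := [set s : R | @grid_shift R eps N i * s < (1 - eps) * mu].
  have mQ i : measurable (Q i).
    by apply: measurable_lt_cst; exact: mulrl_measurable.
  apply: le_trans (majority_of_smoothed_blocks indX distU indXU mQ _); last first.
    by move=> j; exact: (smoothed_lower_tail (S := S j)).
  rewrite le_eqVlt; apply/orP; left; apply/eqP; congr (P _).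
  apply/funext => w; rewrite /= /W /smoothed_median order_statistic_lt//.
  by congr (is_true (_ < _)%N); apply: eq_bigr => j _; rewrite mem_setE.
have mup : measurable [set w | ((1 + eps) * mu < W w)%R].
  exact: measurable_gt_cst.
have mlow : measurable [set w | (W w < (1 - eps) * mu)%R].
  exact: measurable_lt_cst.
apply: (@le_trans _ _ (P ([set w | ((1 + eps) * mu < W w)%R] `|`
    [set w | (W w < (1 - eps) * mu)%R]))).
  apply: le_measure; rewrite ?inE.
  - apply: (measurable_gt_cst (f := fun w => `|W w - mu|)).
    by apply: measurableT_comp => //; exact: measurable_funB.
  - exact: measurableU.
  - by move=> w /=; rewrite -/(W w) ltr_normr => /orP[]; [left|right]; lra.
apply: le_trans (measureU2 _ _ _) _ => //.
by rewrite [(3 / 4) ^+ k]splitr EFinD leeD.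
Qed.

End concentration.

(** * Numerical bounds on the sample sizes *)

Section numerics.
Context (R : realType).

Lemma absz_ceil_ge (x : R) : 0 <= x -> x <= (`|Num.ceil x|%N)%:R.
Proof.
move=> x0; have c0 : 0 <= Num.ceil x by rewrite -(ler_int R) (le_trans x0)// ceil_ge.
by rewrite natr_absz ger0_norm// ceil_ge.
Qed.

(** The other factor of [f_factor eps] is [(1 + eps) / (1 + eps - eps ^+ 2)], which is
    at least 1. *)
Lemma f_factor_ge (eps : R) : 0 < eps -> eps < 1 ->
  (1 - eps) ^- 2 <= f_factor eps.
Proof.
move=> e0 e1; rewrite /f_factor -mulrA ler_peMr ?invr_ge0 ?sqr_ge0//.
rewrite mulrC ler_pdivlMr ?mul1r; first by rewrite lerBlDr lerDl sqr_ge0.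
by rewrite -addrA addr_gt0// subr_gt0 expr2 gtr_pMr.
Qed.

Lemma block_size_suffices (c eps mu : R) :
    0 < c -> 0 < eps -> eps < 1 ->
  let m := `|Num.ceil ((c / eps) ^+ 2 * f_factor eps)%R|%N in
  (0 < m)%N /\ (c * mu) ^+ 2 / m%:R <= (eps * mu * (1 - eps)) ^+ 2.
Proof.
move=> c0 e0 e1 m.
have f1 := f_factor_ge e0 e1.
have f0 : 0 < f_factor eps.
  by apply: lt_le_trans f1; rewrite invr_gt0 exprn_gt0// subr_gt0.
have x0 : 0 < (c / eps) ^+ 2 * f_factor eps.
  by rewrite mulr_gt0// exprn_gt0// divr_gt0.
have xm : (c / eps) ^+ 2 * f_factor eps <= m%:R by exact/absz_ceil_ge/ltW.
have m0 : 0 < m%:R :> R by exact: lt_le_trans xm.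
split; first by rewrite -(ltr_nat R).
rewrite ler_pdivrMr//.
have : (c / eps) ^+ 2 * (1 - eps) ^- 2 <= m%:R.
  by apply: le_trans xm; rewrite ler_wpM2l// sqr_ge0.
have -> : (c / eps) ^+ 2 * (1 - eps) ^- 2 = c ^+ 2 / (eps * (1 - eps)) ^+ 2.
  by field; rewrite !gt_eqF// subr_gt0.
rewrite ler_pdivrMr ?exprn_gt0 ?mulr_gt0 ?subr_gt0// => cm.
rewrite exprMn [X in _ <= X](_ : _ = m%:R * (eps * (1 - eps)) ^+ 2 * mu ^+ 2).
  by rewrite ler_wpM2r ?sqr_ge0.
by ring.
Qed.

(** This fixes the base 4/3 of the logarithm: with [2 * k + 1] blocks, where [k] is
    this ceiling, each tail of the median is at most [(3 / 4) ^+ k / 2]. *)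
Lemma block_number_suffices (delta : R) : 0 < delta -> delta < 1 ->
  (3 / 4) ^+ `|Num.ceil (ln (2 * delta^-1) / ln (4 / 3) : R)%R|%N <= delta / 2.
Proof.
move=> d0 d1; set k := `|_|%N.
have l43 : 0 < ln (4 / 3) :> R by rewrite ln_gt0// ltr_pdivlMr// mul1r ltr_nat.
have d2 : 1 < 2 * delta^-1.
  by rewrite ltr_pdivlMr// mul1r; lra.
have kge : ln (2 * delta^-1) / ln (4 / 3) <= k%:R :> R.
  by apply: absz_ceil_ge; rewrite divr_ge0 ?ltW// ln_gt0.
have -> : delta / 2 = (2 * delta^-1)^-1 by rewrite invfM invrK mulrC.
have -> : (3 / 4 : R) = (4 / 3)^-1 by rewrite invf_div.
rewrite exprVn lef_pV2 ?posrE ?exprn_gt0 ?divr_gt0//.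
rewrite -ler_ln ?posrE ?exprn_gt0 ?mulr_gt0 ?invr_gt0//.
by rewrite lnXn// -[_ *+ k]mulr_natl -ler_pdivrMr.
Qed.

End numerics.

Unset Implicit Arguments.
Set Strict Implicit.

Theorem theorem1 (R : realType) (c eps delta : R) (c_gt0 : 0 < c)
    (eps_gt0 : 0 < eps) (eps_lt : eps < 1 / 3)
    (delta_gt0 : 0 < delta) (delta_lt1 : delta < 1) :
  let t := num_samples c eps delta in
  exists E : randomized_estimator R t,
  forall (d : measure_display) (Omega : measurableType d)
    (P : probability Omega R) (X : nat -> {RV P >-> R}) (mu : R)
    (U : {RV P >-> aux_space E}),
  iid X ->
  (forall i, (X i : Omega -> R) \in Lfun P 1%E) ->
  (forall i, ('E_P[X i])%E = mu%:E) ->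
  (forall i, (std_dev (X i) <= (c * mu)%:E)%E) ->
  has_distribution U (aux_law E) ->
  independent2 P (first_samples t X) U ->
  (P [set w | (eps * mu < `| estimate E (first_samples t X w, U w) - mu |)%R]
    <= delta%:E)%E.
Proof.
have eps_lt1 : eps < 1 by lra.
(* [1 / N.+1 <= eps ^+ 2 / 4] makes the discretization error harmless. *)
pose N := `|Num.ceil (4 / eps ^+ 2)%R|%N.
have N_large : 4 <= N.+1%:R * eps ^+ 2.
  rewrite -ler_pdivrMr ?exprn_gt0// (le_trans (absz_ceil_ge _))//.
    by rewrite divr_ge0// sqr_ge0.
  by rewrite ler_nat.
pose m := `|Num.ceil ((c / eps) ^+ 2 * f_factor eps)%R|%N.
pose k := `|Num.ceil (ln (2 * delta^-1) / ln (4 / 3) : R)%R|%N.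
have kdelta : (3 / 4) ^+ k <= delta / 2 :> R by exact: block_number_suffices.
pose E := @smoothed_median_estimator R m k N eps.
move=> t; exists (E : randomized_estimator R t).
move=> d Omega P X mu U [indX _] _ EX sX distU indXU.
have [m_gt0 m_large] := block_size_suffices mu c_gt0 eps_gt0 eps_lt1.
rewrite -/m in m_gt0 m_large.
have mu_ge0 : 0 <= mu.
  rewrite -(pmulr_rge0 _ c_gt0) -lee_fin (le_trans _ (sX 0%N))//.
  exact: sqrte_ge0.
have VX i : ('V_P[X i] <= ((c * mu) ^+ 2)%:E)%E by exact: std_dev_le_variance.
have X2 i : (X i : Omega -> R) \in Lfun P 2%:E.
  by apply: finite_variance_Lfun2; rewrite (le_lt_trans (VX i))// ltry.
apply: le_trans (smoothed_median_concentration eps_gt0 eps_lt1 mu_ge0 N_large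
  m_gt0 m_large indX X2 EX VX distU indXU) _.
by rewrite lee_fin (le_trans kdelta)//; lra.
Qed.
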